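(* Let $\kappa\in\{1,2,3,\dots\}\cup\{\infty\}$, let $\sum_{\overline M}$ be a $\kappa$-solenoid and let $\mathbf\omega,\mathbf\omega'\in\mathbb R^\kappa-\{\mathbf 0\}$. If the linear flows $\Phi^{\mathbf\omega}_{\overline M}$ and $\Phi^{\mathbf\omega'}_{\overline M}$ on $\sum_{\overline M}$ are topologically equivalent, then there are a topological group automorphism $a$ of $\sum_{\overline M}$ and an increasing continuous homomorphism $\beta:\mathbb R\to\mathbb R$ such that $\beta\times a$ is an equivalence from $\Phi^{\mathbf\omega}_{\overline M}$ to $\Phi^{\mathbf\omega'}_{\overline M}$, i.e. $a\big(\Phi^{\mathbf\omega}_{\overline M}(t,x)\big)=\Phi^{\mathbf\omega'}_{\overline M}\big(\beta(t),a(x)\big)$ for all $t\in\mathbb R$ and $x\in\sum_{\overline M}$.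
   Context: All homomorphisms and automorphisms of topological groups are continuous (automorphisms in both directions). $S^1=\mathbf T^1=\mathbb R/\mathbb Z$, $\mathbf T^\kappa=\prod_{i=1}^\kappa S^1$, where $\infty$ is the countably infinite cardinal; $\mathbf T^\kappa$ and $\mathbb R^\kappa$ carry the product topology. $p^\kappa:\mathbb R^\kappa\to\mathbf T^\kappa$ is coordinatewise reduction mod $1$. $\kappa$-solenoids. (i) For $\kappa=n<\infty$: given a sequence $\overline M=(M_1,M_2,\dots)$ of $n\times n$ integer matrices with non-zero determinants, the $n$-solenoid $\sum_{\overline M}$ is the inverse limit $\{(\mathbf x^j)_{j\ge1}\in\prod_{j=1}^\infty\mathbf T^n: \mathbf x^j=f_j^{j+1}(\mathbf x^{j+1})\ \forall j\}$, where $f_j^{j+1}:\mathbf T^n\to\mathbf T^n$ is the epimorphism with $f_j^{j+1}\circ p^n=p^n\circ M_j$. (ii) For $\kappa=\infty$: given for each $i$ an integer $n_i\geq 1$ and an $n_i\times n_i$ integer matrix $M_i$ with non-zero determinant, let $M_i\times id:\mathbb R^\infty\to\mathbb R^\infty$ act by $M_i$ on the first $n_i$ coordinates and by the identity on the others; the $\infty$-solenoid $\sum_{\overline M}$ is the inverse limit in $\prod_{j=1}^\infty\mathbf T^\infty$ of copies of $\mathbf T^\infty$ with bonding maps $f_i^{i+1}$ satisfying $f_i^{i+1}\circ p^\infty=p^\infty\circ(M_i\times id)$. These are topological groups under coordinatewise addition. The homomorphism $\pi_{\overline M}:\mathbb R^\kappa\to\sum_{\overline M}$ is $\mathbf t\mapsto\big(p^\kappa(\mathbf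 t),\,p^\kappa(M_1^{-1}\mathbf t),\dots,\,p^\kappa(M_j^{-1}\cdots M_1^{-1}\mathbf t),\dots\big)$, with $M_i^{-1}$ replaced by $M_i^{-1}\times id$ if $\kappa=\infty$. For $\mathbf\omega\in\mathbb R^\kappa-\{\mathbf 0\}$ the linear flow is $\Phi^{\mathbf\omega}_{\overline M}:\mathbb R\times\sum_{\overline M}\to\sum_{\overline M}$, $\Phi^{\mathbf\omega}_{\overline M}(t,x)=\pi_{\overline M}(t\mathbf\omega)+x$. Flows $\phi:\mathbb R\times X\to X$ and $\psi:\mathbb R\times Y\to Y$ are topologically equivalent if there is a homeomorphism $h:X\to Y$ mapping each trajectory of $\phi$ onto a trajectory of $\psi$ and preserving orientation of orbits: for each $x\in X$ there is an increasing homeomorphism $\alpha_x:\mathbb R\to\mathbb R$ with $h(\phi(t,x))=\psi(\alpha_x(t),h(x))$ for all $t\in\mathbb R$. *)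

(* Defs.v *)
From HB Require Import structures.
From mathcomp Require Import all_boot all_order all_algebra.
From mathcomp Require Import all_classical all_reals all_analysis.

Set Implicit Arguments.
Unset Strict Implicit.
Unset Printing Implicit Defensive.

Import Order.TTheory GRing.Theory Num.Theory.
Import numFieldNormedType.Exports Quotient.

Local Open Scope classical_set_scope.
Local Open Scope ring_scope.

Section Circle.
Variable R : realType.

Definition int_pred : {pred R} := fun x => x \is a Num.int.

Fact int_pred_zmod_closed : zmod_closed int_pred.
Proof. by split=> [|x y xZ yZ]; [exact: rpred0 | exact: rpredB]. Qed.

HB.instance Definition _ :=
  GRing.isZmodClosed.Build R int_pred int_pred_zmod_closed.

(* S^1 = R/Z, with the quotient group structure and the quotient topology. *)
Definition circle : Type := quotient_topology {quot int_pred}.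

HB.instance Definition _ := Topological.on circle.
HB.instance Definition _ := Quotient.on circle.
HB.instance Definition _ := @GRing.isZmodule.Build circle _ _ _
  (@addqA _ int_pred) (@addqC _ int_pred) (@add0q _ int_pred)
  (@addNq _ int_pred).

Definition to_circle (x : R) : circle := (\pi_circle x)%qT.

Lemma to_circle_is_zmod_morphism : zmod_morphism to_circle.
Proof. exact: (@pi_is_zmod_morphism _ _ _ {quot int_pred}). Qed.

HB.instance Definition _ :=
  GRing.isZmodMorphism.Build R circle to_circle to_circle_is_zmod_morphism.

End Circle.

(* The cardinal kappa >= 1: [Fin n] stands for the finite cardinal n.+1, and
   [Infty] for the countably infinite one. *)
Inductive dimension := Fin of nat | Infty.

Definition idx (kappa : dimension) : Type :=
  if kappa is Fin n then 'I_n.+1 else nat.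

(* T^kappa, with the product topology. *)
Definition torus (R : realType) (kappa : dimension) : Type :=
  {ptws idx kappa -> circle R}.

HB.instance Definition _ (R : realType) (kappa : dimension) :=
  Topological.on (torus R kappa).
HB.instance Definition _ (R : realType) (kappa : dimension) :=
  GRing.Zmodule.copy (torus R kappa) (idx kappa -> circle R).

Definition to_torus (R : realType) (kappa : dimension) (t : idx kappa -> R) :
    torus R kappa :=
  fun k => to_circle (t k).

(* The data of one bonding map; the size of the matrix is n.+1 in both cases. *)
Definition bonding (kappa : dimension) : Type :=
  match kappa with
  | Fin n => {M : 'M[int]_n.+1 | \det M != 0}
  | Infty => {n : nat & {M : 'M[int]_n.+1 | \det M != 0}}
  end.

(* f x id, for f acting on the first n coordinates. *)
Definition times_id (V : Type) (n : nat) (f : ('I_n -> V) -> ('I_n -> V))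
    (x : nat -> V) : nat -> V :=
  fun k => if insub k is Some i then f (fun j => x j) i else x k.

Definition int_mul (V : zmodType) (n : nat) (A : 'M[int]_n) (x : 'I_n -> V) :
    'I_n -> V :=
  fun i => \sum_j x j *~ A i j.

Definition real_mul (R : realType) (n : nat) (A : 'M[R]_n) (x : 'I_n -> R) :
    'I_n -> R :=
  fun i => \sum_j A i j * x j.

(* For V = R, this is the linear map M (resp. M x id) of R^kappa; for V = S^1 it
   is the map that it induces on T^kappa, see [bond_to_torus]. *)
Definition bond (V : zmodType) (kappa : dimension) :
    bonding kappa -> (idx kappa -> V) -> (idx kappa -> V) :=
  match kappa with
  | Fin n => fun M => int_mul (sval M)
  | Infty => fun M => times_id (int_mul (sval (tagged M)))
  end.

(* M^-1 (resp. M^-1 x id) on R^kappa, the two-sided inverse of [bond] by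
   [bond_invK] and [bondK]. *)
Definition bond_inv (R : realType) (kappa : dimension) :
    bonding kappa -> (idx kappa -> R) -> (idx kappa -> R) :=
  match kappa with
  | Fin n => fun M => real_mul (invmx (map_mx intr (sval M)))
  | Infty => fun M => times_id (real_mul (invmx (map_mx intr (sval (tagged M)))))
  end.

Lemma int_mul_intr (R : realType) (n : nat) (A : 'M[int]_n) (x : 'I_n -> R) :
  int_mul A x = real_mul (map_mx intr A) x.
Proof.
by apply/funext => i; apply: eq_bigr => j _; rewrite mxE mulrzl.
Qed.

Lemma real_mulM (R : realType) (n : nat) (A B : 'M[R]_n) (x : 'I_n -> R) :
  real_mul A (real_mul B x) = real_mul (A *m B) x.
Proof.
apply/funext => i; rewrite /real_mul.
under eq_bigr do rewrite mulr_sumr.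
rewrite exchange_big; apply: eq_bigr => j _; rewrite mxE mulr_suml.
by apply: eq_bigr => k _; rewrite mulrA.
Qed.

Lemma real_mul1 (R : realType) (n : nat) (x : 'I_n -> R) :
  real_mul 1%:M x = x.
Proof.
apply/funext => i; rewrite /real_mul (bigD1 i) //= big1 ?addr0.
  by rewrite mxE eqxx mul1r.
by move=> j ji; rewrite mxE eq_sym (negPf ji) mul0r.
Qed.

Lemma intr_unitmx (R : realType) (n : nat) (A : 'M[int]_n) :
  \det A != 0 -> map_mx intr A \in @unitmx R n.
Proof. by move=> A0; rewrite unitmxE det_map_mx unitfE intr_eq0. Qed.

Lemma int_mulK (R : realType) (n : nat) (A : 'M[int]_n) (x : 'I_n -> R) :
  \det A != 0 -> int_mul A (real_mul (invmx (map_mx intr A)) x) = x.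
Proof.
move=> A0; rewrite int_mul_intr real_mulM mulmxV ?real_mul1 //.
exact: intr_unitmx.
Qed.

Lemma real_mulK (R : realType) (n : nat) (A : 'M[int]_n) (x : 'I_n -> R) :
  \det A != 0 -> real_mul (invmx (map_mx intr A)) (int_mul A x) = x.
Proof.
move=> A0; rewrite int_mul_intr real_mulM mulVmx ?real_mul1 //.
exact: intr_unitmx.
Qed.

Lemma times_idK (V : Type) (n : nat) (f g : ('I_n -> V) -> ('I_n -> V)) :
  cancel f g -> cancel (times_id f) (times_id g).
Proof.
move=> fgK x; apply/funext => k; rewrite /times_id.
have E : (fun j : 'I_n =>
    if insub (val j) is Some i then f (fun j => x (val j)) i else x (val j))
    = f (fun j => x (val j)).
  by apply/funext => j; rewrite valK.
by case: (@insubP _ _ 'I_n k) => [i _ ik|//]; rewrite E fgK ik.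
Qed.

Lemma bond_invK (R : realType) (kappa : dimension) (M : bonding kappa) :
  cancel (@bond_inv R kappa M) (bond M).
Proof.
case: kappa M => [n|] M; first by move=> x; exact: int_mulK (svalP M).
by apply: times_idK => x; exact: int_mulK (svalP (tagged M)).
Qed.

Lemma bondK (R : realType) (kappa : dimension) (M : bonding kappa) :
  cancel (bond M) (@bond_inv R kappa M).
Proof.
case: kappa M => [n|] M; first by move=> x; exact: real_mulK (svalP M).
by apply: times_idK => x; exact: real_mulK (svalP (tagged M)).
Qed.

Lemma int_mul_morph (U V : zmodType) (g : {additive U -> V}) (n : nat)
    (A : 'M[int]_n) (x : 'I_n -> U) :
  int_mul A (g \o x) = g \o int_mul A x.
Proof.
apply/funext => i; rewrite /int_mul /= raddf_sum.
by apply: eq_bigr => j _; rewrite raddfMz.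
Qed.

Lemma bond_morph (U V : zmodType) (g : {additive U -> V}) (kappa : dimension)
    (M : bonding kappa) (x : idx kappa -> U) :
  bond M (g \o x) = g \o bond M x.
Proof.
case: kappa M x => [n|] M x; first exact: int_mul_morph.
apply/funext => k; rewrite /= /times_id; case: insub => // i.
exact: (congr1 (fun h => h i) (int_mul_morph g _ (fun j => x j))).
Qed.

Lemma bond_to_torus (R : realType) (kappa : dimension) (M : bonding kappa)
    (t : idx kappa -> R) :
  bond M (to_torus t) = to_torus (bond M t).
Proof. exact: (bond_morph (@to_circle R)). Qed.

Lemma bondB (V : zmodType) (kappa : dimension) (M : bonding kappa)
    (x y : idx kappa -> V) :
  bond M (x - y) = bond M x - bond M y.
Proof.
case: kappa M x y => [n|] M x y; apply/funext => k; rewrite !fctE /=.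
  by rewrite /int_mul -sumrB; apply: eq_bigr => j _; exact: mulrzBl.
rewrite /times_id; case: insub => // i.
by rewrite /int_mul -sumrB; apply: eq_bigr => j _; exact: mulrzBl.
Qed.

Section Solenoid.
Variables (R : realType) (kappa : dimension) (M : nat -> bonding kappa).

(* Matrices and factors are indexed from 0: [M j] is the matrix M_(j+1), and
   the coordinate [x j] is x^(j+1). *)
Definition tower : Type := {ptws nat -> torus R kappa}.

HB.instance Definition _ := Topological.on tower.
HB.instance Definition _ :=
  GRing.Zmodule.copy tower (nat -> torus R kappa).

Definition inverse_limit : {pred tower} :=
  fun x => `[< forall j, x j = bond (M j) (x j.+1) >].

Fact inverse_limit_zmod_closed : zmod_closed inverse_limit.
Proof.
split=> [|x y /asboolP xM /asboolP yM]; apply/asboolP => j.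
  by rewrite -[X in bond _ X](subrr (0 : idx kappa -> circle R)) bondB subrr.
by rewrite [RHS](bondB (M j) (x j.+1) (y j.+1)) -xM -yM.
Qed.

HB.instance Definition _ :=
  GRing.isZmodClosed.Build tower inverse_limit inverse_limit_zmod_closed.

Record solenoid : Type := Solenoid {
  coords : tower;
  coordsP : coords \in inverse_limit
}.

HB.instance Definition _ := [isSub for coords].
HB.instance Definition _ := [Choice of solenoid by <:].
HB.instance Definition _ := [SubChoice_isSubZmodule of solenoid by <:].
HB.instance Definition _ :=
  Topological.copy solenoid (initial_topology coords).

(* M_j^-1 ... M_1^-1 t *)
Fixpoint unwind (t : idx kappa -> R) (j : nat) : idx kappa -> R :=
  if j is j'.+1 then bond_inv (M j') (unwind t j') else t.

Lemma unwind_inverse_limit (t : idx kappa -> R) :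
  ((fun j => to_torus (unwind t j)) : tower) \in inverse_limit.
Proof. by apply/asboolP => j; rewrite bond_to_torus /= bond_invK. Qed.

Definition to_solenoid (t : idx kappa -> R) : solenoid :=
  Solenoid (unwind_inverse_limit t).

Definition linear_flow (w : idx kappa -> R) (t : R) (x : solenoid) : solenoid :=
  to_solenoid (t *: w) + x.

End Solenoid.

Arguments linear_flow {R kappa} M w t x.

Definition homeomorphism (X Y : topologicalType) (h : X -> Y) : Prop :=
  continuous h /\
  exists g : Y -> X, [/\ cancel h g, cancel g h & continuous g].

(* Since alpha is onto, h maps the trajectory of x onto that of h x. *)
Definition topologically_equivalent (R : realType) (X Y : topologicalType)
    (phi : R -> X -> X) (psi : R -> Y -> Y) : Prop :=
  exists h : X -> Y, homeomorphism h /\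
    forall x, exists alpha : R -> R,
      [/\ homeomorphism alpha, {homo alpha : s t / s < t}
        & forall t, h (phi t x) = psi (alpha t) (h x)].

(* Main.v *)
Require Import Defs.
From HB Require Import structures.
From mathcomp Require Import all_boot all_order all_algebra.
From mathcomp Require Import all_classical all_reals all_analysis.
From mathcomp Require Import ring lra zify.

(** Write [S] for the solenoid, [V] for the vector space R^kappa and [p] for the
    homomorphism [to_solenoid] from [V] to [S].

    Composing the given equivalence with a translation, which commutes with the
    linear flows, yields a homeomorphism [h] that fixes 0 and maps orbits to
    orbits. The automorphism is the homomorphism homotopic to [h]: there are a
    continuous endomorphism [a] of [S] and a continuous [F : S -> V] such that
    [h x = a x + p (F x)] ([solenoid_map_decomposition]). This comes from a fact
    on compact connected groups, applied to the coordinates of [h]: a continuous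
    map to the circle is, up to a constant, a character plus the class of a
    continuous real function ([character_decomposition]). To find the
    character, lift each increment [x |-> f (x + g) - f x] to a real function and
    take the asymptotic average of the lift along the multiples of [g]; the
    oscillations of these lifts are bounded uniformly in [g], which makes the
    average exist and depend additively on [g]. The character is unique
    ([morph_lift_eq0]), because a real lift of a homomorphism is additive and
    bounded, hence zero.

    A continuous endomorphism of [S] is covered by a continuous additive map of
    [V] ([solenoid_endomorphism_lift]). Let [A] cover [a]. Uniqueness of the
    homomorphic part shows that the endomorphism attached to the inverse of [h]
    is inverse to [a] ([homotopy_inverse]), so [a] is an automorphism.

    Along the orbit of 0, the relation between the two flows reads
    [p (A (t w) + F (p (t w))) = p (alpha t w')] with [alpha] increasing. Paths
    lift uniquely, so [gamma t w' = A (t w) + F (p (t w))], where [gamma] is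
    [alpha - alpha 0]. As [S] is compact, [F] is bounded in each coordinate,
    and an additive path that stays within bounded distance of the line of
    [w'] lies on it ([asymptotic_direction]): [A (t w) = beta t w'] with [beta]
    additive. It is nonnegative for [t > 0] because [gamma] is, and it does not
    vanish there because [a] is injective and [w] is nonzero. Applying [p] gives
    [a (p (t w)) = p (beta t w')], which is the required identity. *)

Set Implicit Arguments.
Unset Strict Implicit.
Unset Printing Implicit Defensive.

Import Order.TTheory GRing.Theory Num.Theory.
Import numFieldNormedType.Exports.

Local Open Scope classical_set_scope.
Local Open Scope ring_scope.

(** * The circle as a topological group *)

Lemma int_lt1_eq0 (R : realType) (r : R) : r \is a Num.int -> `|r| < 1 -> r = 0.
Proof.
move=> /intrP[m ->]; rewrite -intr_norm -(mulr1z (1 : R)) ltr_int => h.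
by have -> : m = 0 by lia.
Qed.

Section CircleTheory.
Variable R : realType.
Implicit Types (p q : circle R) (r s : R).

Lemma to_circle_eq0 r : (to_circle r == 0) = (r \is a Num.int).
Proof.
rewrite -(raddf0 (@to_circle R)); have := Quotient.idealrBE (@int_pred R) r 0.
by rewrite subr0 => ->; apply/eqP/eqP.
Qed.

(** The representative of [p] in [-1/2, 1/2): its absolute value is the usual
    translation-invariant norm of the circle, and it is the only local inverse
    of [to_circle] that the proof uses. *)
Definition centered p : R := repr p - (Num.floor (repr p + 2^-1))%:~R.

Lemma centeredK p : to_circle (centered p) = p.
Proof.
rewrite /centered raddfB /=.
have /eqP -> : to_circle ((Num.floor (repr p + 2^-1))%:~R : R) == 0.
  by rewrite to_circle_eq0 intr_int.
by rewrite subr0 /to_circle reprK.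
Qed.

Lemma centered_bounds p : - 2^-1 <= centered p < 2^-1.
Proof.
rewrite /centered; have := floor_itv (repr p + 2^-1).
by rewrite intrD1; lra.
Qed.

Lemma centered_to_circle r : `|r| < 2^-1 -> centered (to_circle r) = r.
Proof.
move=> hr; apply/eqP; rewrite -subr_eq0; apply/eqP/int_lt1_eq0.
  by rewrite -to_circle_eq0 raddfB /= centeredK subrr.
by move: hr (centered_bounds (to_circle r)); rewrite !ltr_norml; lra.
Qed.

Lemma ler_centered r : `|centered (to_circle r)| <= `|r|.
Proof.
have [h|h] := ltP `|r| 2^-1; first by rewrite centered_to_circle.
by apply: le_trans h; have := centered_bounds (to_circle r); rewrite ler_norml; lra.
Qed.

Lemma centered0 : centered 0 = 0.
Proof. by rewrite -(raddf0 (@to_circle R)) centered_to_circle // normr0; lra. Qed.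

Lemma ler_centeredD p q : `|centered (p + q)| <= `|centered p| + `|centered q|.
Proof.
rewrite -{1}(centeredK p) -{1}(centeredK q) -raddfD.
by rewrite (le_trans (ler_centered _)) ?ler_normD.
Qed.

(** As long as the two norms add up to less than 1/2, no reduction modulo 1
    takes place. *)
Lemma centeredD p q : `|centered p| + `|centered q| < 2^-1 ->
  centered (p + q) = centered p + centered q.
Proof.
move=> h; rewrite -{1}(centeredK p) -{1}(centeredK q) -raddfD /= centered_to_circle //.
exact: le_lt_trans (ler_normD _ _) h.
Qed.

Lemma norm_centeredN p : `|centered (- p)| = `|centered p|.
Proof.
apply/eqP; rewrite eq_le.
have H q : `|centered (- q)| <= `|centered q|.
  by rewrite -{1}(centeredK q) -raddfN (le_trans (ler_centered _)) ?normrN.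
by rewrite H -{1}(opprK p) H.
Qed.

Lemma centered_eq0 p : (centered p == 0) = (p == 0).
Proof.
apply/eqP/eqP => [h|->]; last exact: centered0.
by rewrite -(centeredK p) h raddf0.
Qed.

Lemma to_circle_continuous : continuous (@to_circle R).
Proof. exact: pi_continuous. Qed.

(** The quotient topology is the topology of the norm [`|centered _|]; every
    later continuity argument on the circle goes through this description. *)
Lemma nbhs_circleP p (A : set (circle R)) :
  nbhs p A <-> exists2 e : R, 0 < e & forall q, `|centered (q - p)| < e -> A q.
Proof.
split=> [|[e e0 pA]].
  rewrite -{1}(centeredK p) => /to_circle_continuous /nbhs_ballP[e /= e0 eA].
  exists e => // q qe.
  have -> : q = to_circle (centered p + centered (q - p)).
    by rewrite raddfD /= !centeredK addrC subrK.
  by apply: eA; rewrite -ball_normE /= opprD addNKr normrN.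
rewrite nbhsE; exists [set q | `|centered (q - p)| < e]; last by move=> q /pA.
split; last by rewrite /= subrr centered0 normr0.
change (open (@to_circle R @^-1` [set q | `|centered (q - p)| < e])).
rewrite openE => r /= re.
apply/nbhs_ballP; exists (e - `|centered (to_circle r - p)|).
  by rewrite /= subr_gt0.
move=> s; rewrite -ball_normE /= => rs.
rewrite -(subrK (to_circle r) (to_circle s)) -addrA -raddfB.
apply: (le_lt_trans (ler_centeredD _ _)).
rewrite -ltrBrDr; apply: le_lt_trans rs.
by rewrite [leRHS]distrC; exact: ler_centered.
Qed.

Lemma cvg_circleP (T : Type) (F : set_system T) (f : T -> circle R) p :
  Filter F ->
  f x @[x --> F] --> p <->
  forall e, 0 < e -> \forall x \near F, `|centered (f x - p)| < e.
Proof.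
move=> FF; split=> [Fp e e0|H A /nbhs_circleP[e e0 eA]].
  by apply: (Fp [set q | `|centered (q - p)| < e]); apply/nbhs_circleP; exists e.
by apply: filterS (H _ e0) => x; exact: eA.
Qed.

Lemma circle_sub_continuous : continuous (fun x : circle R * circle R => x.1 - x.2).
Proof.
move=> [p q]; apply/cvg_circleP => e e0.
have e20 : 0 < e / 2 by lra.
have hp : \forall p' \near p, `|centered (p' - p)| < e / 2.
  by apply/nbhs_circleP; exists (e / 2).
have hq : \forall q' \near q, `|centered (q' - q)| < e / 2.
  by apply/nbhs_circleP; exists (e / 2).
near=> x; rewrite /=.
have -> : x.1 - x.2 - (p - q) = (x.1 - p) + - (x.2 - q).
  by rewrite !opprD addrACA.
apply: le_lt_trans (ler_centeredD _ _) _; rewrite norm_centeredN.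
have -> : e = e / 2 + e / 2 by lra.
by apply: ltrD; near: x; [exact: (cvg_fst hp)|exact: (cvg_snd hq)].
Unshelve. all: by end_near. Qed.

HB.instance Definition _ := PreTopologicalNmodule_isTopologicalZmodule.Build
  (circle R) circle_sub_continuous.

Lemma centered_continuous p : `|centered p| < 2^-1 -> {for p, continuous centered}.
Proof.
move=> hp; have FF : Filter (nbhs p) by exact: nbhs_filter.
apply/cvgrPdist_lt => e e0.
have d0 : 0 < Num.min e (2^-1 - `|centered p|) by rewrite lt_min e0 subr_gt0.
apply/nbhs_circleP; exists (Num.min e (2^-1 - `|centered p|)) => // q.
rewrite lt_min => /andP[h1 h2].
rewrite -(subrK p q) centeredD; last by rewrite -ltrBrDr.
by rewrite opprD addrCA subrr addr0 normrN.
Qed.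

Lemma circle_compact : compact [set: circle R].
Proof.
have -> : [set: circle R] = @to_circle R @` `[- 2^-1, 2^-1]%classic.
  apply/seteqP; split=> // p _; exists (centered p); last exact: centeredK.
  by rewrite /= in_itv /=; have := centered_bounds p; lra.
apply: continuous_compact; last exact: segment_compact.
exact/continuous_subspaceT/to_circle_continuous.
Qed.

End CircleTheory.

Lemma cvg_to_circle (R : realType) (T : Type) (F : set_system T) (f : T -> R) (a : R) :
  Filter F -> f @ F --> a -> to_circle (f x) @[x --> F] --> to_circle a.
Proof. by move=> FF fa; apply: continuous_cvg fa; exact: to_circle_continuous. Qed.

(** * Compact connected topological groups *)

Lemma tzmod_cvgB (T : Type) (F : set_system T) (M : topologicalZmodType)
    (f g : T -> M) (a b : M) : Filter F ->
  f @ F --> a -> g @ F --> b -> (f x - g x) @[x --> F] --> a - b.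
Proof.
move=> FF; apply: (@continuous2_cvg _ _ _ _ _ _ f g (fun x y => x - y)).
exact: (@sub_continuous M (a, b)).
Qed.

Lemma tzmod_cvgD (T : Type) (F : set_system T) (M : topologicalZmodType)
    (f g : T -> M) (a b : M) : Filter F ->
  f @ F --> a -> g @ F --> b -> (f x + g x) @[x --> F] --> a + b.
Proof.
move=> FF; apply: (@continuous2_cvg _ _ _ _ _ _ f g (fun x y => x + y)).
exact: (@add_continuous M (a, b)).
Qed.

Lemma near_translate (G : topologicalZmodType) (x : G) (P : G -> Prop) :
  (\forall u \near 0, P u) -> \forall y \near x, P (y - x).
Proof.
have : (y - x) @[y --> x] --> x - x.
  by apply: tzmod_cvgB; [exact: cvg_id|exact: cvg_cst].
by rewrite subrr; apply.
Qed.

Lemma translate_continuous (G : topologicalZmodType) (X : topologicalType)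
  (f : G -> X) (g : G) : continuous f -> continuous (fun x => f (x + g)).
Proof.
move=> cf x; apply: (@continuous_comp _ _ _ (fun x => x + g) f); last exact: cf.
by apply: tzmod_cvgD; [exact: cvg_id|exact: cvg_cst].
Qed.

Lemma bounded_multiples_eq0 (R : realType) (r B : R) :
  (forall n, n%:R * `|r| <= B) -> r = 0.
Proof.
move=> H; apply/eqP; rewrite -normr_eq0; apply/eqP.
apply: le_anti; rewrite normr_ge0 andbT leNgt; apply/negP => r0.
have := H (Num.Def.truncn (B / `|r|)).+1.
by rewrite -ler_pdivlMr // leNgt truncnS_gt.
Qed.

(** Homogenization of a sequence that is additive up to a bounded error: each
    interval [(s n - C) / n, (s n + C) / n] meets every other one, because
    [s (m * n)] is close to both [m * s n] and [n * s m]; the slope is a common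
    point of these intervals. *)
Lemma quasi_additive_slope (R : realType) (s : nat -> R) (C : R) :
  (forall m n, `|s (m + n)%N - s m - s n| <= C) ->
  exists c, forall n, `|s n - n%:R * c| <= C.
Proof.
move=> sC.
have smul m n : `|s (m.+1 * n)%N - m.+1%:R * s n| <= m%:R * C.
  elim: m => [|m IHm]; first by rewrite mul1n mul1r subrr normr0 mul0r.
  have := sC n (m.+1 * n)%N; rewrite -mulSn => h.
  have -> : s (m.+2 * n)%N - m.+2%:R * s n =
    (s (m.+2 * n)%N - s n - s (m.+1 * n)%N) + (s (m.+1 * n)%N - m.+1%:R * s n).
    by rewrite -[m.+2%:R]natr1; ring.
  apply: le_trans (ler_normD _ _) (le_trans (lerD h IHm) _).
  by rewrite -[m.+1%:R]natr1 mulrDl mul1r addrC.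
have C0 : 0 <= C by apply: le_trans (sC 0%N 0%N).
have cross m n : (s m.+1 - C) / m.+1%:R <= (s n.+1 + C) / n.+1%:R.
  rewrite ler_pdivrMr ?ltr0Sn // mulrAC ler_pdivlMr ?ltr0Sn //.
  have := smul m n.+1; have := smul n m.+1; rewrite mulnC !ler_norml.
  by rewrite -[m.+1%:R]natr1 -[n.+1%:R]natr1; lra.
pose E := [set x | exists n, x = (s n.+1 - C) / n.+1%:R].
have E0 : E !=set0 by exists ((s 1%N - C) / 1%:R), 0%N.
have Eub n : ubound E ((s n.+1 + C) / n.+1%:R) by move=> _ [m ->].
exists (sup E) => -[|n].
  by rewrite mul0r subr0; have := sC 0%N 0%N; rewrite addn0 addrAC subrr sub0r normrN.
have h1 : (s n.+1 - C) / n.+1%:R <= sup E.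
  by apply: ub_le_sup; [exists ((s 1%N + C) / 1%:R); exact: Eub|exists n].
have h2 : sup E <= (s n.+1 + C) / n.+1%:R by apply: ge_sup.
move: h1 h2; rewrite ler_pdivrMr ?ltr0Sn // ler_pdivlMr ?ltr0Sn // ler_norml.
by lra.
Qed.

Lemma connected_int_const (R : realType) (T : topologicalType) (k : T -> R) :
  connected [set: T] -> continuous k -> (forall x, k x \is a Num.int) ->
  forall x y, k x = k y.
Proof.
move=> cT ck kint.
have Ik : is_interval (range k).
  apply/connected_intervalP/connected_continuous_connected => //.
  exact: continuous_subspaceT.
have kle x y : k x <= k y.
  rewrite leNgt; apply/negP => xy.
  have h : 1 <= k x - k y.
    rewrite leNgt; apply/negP => h.
    have /int_lt1_eq0 : k x - k y \is a Num.int by exact: rpredB.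
    by rewrite gtr0_norm ?subr_gt0 // => /(_ h); lra.
  have [] := Ik (k y) (k x) _ _ (k y + 2^-1); [by exists y|by exists x|lra|].
  move=> z _ kz.
  have /int_lt1_eq0 : k z - k y \is a Num.int by exact: rpredB.
  by rewrite kz addrC addKr ger0_norm; lra.
by move=> x y; apply: le_anti; rewrite !kle.
Qed.

Lemma compact_bounded_fun (R : realType) (T : topologicalType) (k : T -> R) :
  compact [set: T] -> continuous k -> exists B, forall x, `|k x| <= B.
Proof.
move=> /compact_near_coveringP cT ck.
have : \forall B \near +oo, [set: T] `<=` (fun x => `|k x| <= B).
  apply: cT => x _; near=> x' B => /=.
  apply: (@le_trans _ _ (`|k x| + 1)); last by near: B; exact: nbhs_pinfty_ge.
  have h : `|k x - k x'| < 1.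
    by near: x'; move/cvgrPdist_lt: (ck x); apply; exact: ltr01.
  have -> : k x' = k x - (k x - k x') by ring.
  by apply: le_trans (ler_normB _ _) _; rewrite lerD2l ltW.
move=> H; have [B HB] : exists B, [set: T] `<=` (fun x => `|k x| <= B).
  exact: (@filter_ex _ (pinfty_nbhs R)) H.
by exists B => x; exact: HB.
Unshelve. all: by end_near. Qed.

(** An open subgroup is also closed, its complement being a union of cosets. *)
Lemma connected_open_subgroup (G : topologicalZmodType) (H : set G) :
  connected [set: G] -> nbhs 0 H -> (forall x y, H x -> H y -> H (x - y)) ->
  forall x, H x.
Proof.
move=> cG H0 HB x.
have H00 : H 0 by exact: nbhs_singleton.
have HN y : H y -> H (- y) by rewrite -sub0r; exact: HB.
have HD y z : H y -> H z -> H (y + z).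
  by move=> ? ?; rewrite -(opprK z); apply: HB => //; exact: HN.
suff -> : H = setT by [].
apply: cG; first by exists 0.
- exists H; last by rewrite setTI.
  rewrite openE => y Hy; rewrite /interior.
  near=> z; rewrite -(subrK y z); apply: HD => //.
  by near: z; exact: near_translate.
exists H; last by rewrite setTI.
rewrite -openC openE => y /= nHy; rewrite /interior.
near=> z => nz; apply: nHy; rewrite -(subKr z y); apply: HB => //.
by near: z; exact: near_translate.
Unshelve. all: by end_near. Qed.

(** * Characters and maps to the circle *)

(** Throughout this section [f] is a map from a compact connected group to the
    circle. It differs from a character by a real-valued function, and the
    character is recovered from the increments [x |-> f (x + g) - f x]: each of
    them lifts to a real function, and the average slope of such a lift along
    the multiples of [g] is a real number whose class modulo 1 depends
    additively on [g]. *)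
Section Decomposition.
Variables (R : realType) (G : topologicalZmodType).
Hypothesis G_compact : compact [set: G].
Hypothesis G_connected : connected [set: G].
Variable f : G -> circle R.
Hypothesis f_continuous : continuous f.

Implicit Types (g u x y : G) (d : G -> R) (c : R).

Definition lifts g d :=
  continuous d /\ forall x, to_circle (d x) = f (x + g) - f x.

Lemma lifts0 : lifts 0 (fun=> 0).
Proof. by split=> [x|x]; [exact: cvg_cst|rewrite raddf0 addr0 subrr]. Qed.

(** The cocycle rule for increments. It is not symmetric in [g] and [h]; that
    the two possible lifts of the increment by [g + h] agree is [lifts_comm]. *)
Lemma liftsD g h d e : lifts g d -> lifts h e ->
  lifts (g + h) (fun x => d (x + h) + e x).
Proof.
move=> [cd Hd] [ce He]; split=> [x|x].
  by apply: cvgD; [exact: translate_continuous|exact: ce].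
by rewrite raddfD /= Hd He (addrC g) (addrA x) [LHS]addrA subrK.
Qed.

Lemma liftsN g d : lifts g d -> lifts (- g) (fun x => - d (x - g)).
Proof.
move=> [cd Hd]; split=> [x|x].
  by apply: cvgN; exact: translate_continuous.
by rewrite raddfN /= Hd subrK opprB.
Qed.

Lemma lifts_const g d e : lifts g d -> lifts g e ->
  exists2 m, m \is a Num.int & forall x, e x = d x + m.
Proof.
move=> [cd Hd] [ce He].
have edint x : e x - d x \is a Num.int.
  by rewrite -to_circle_eq0 raddfB /= Hd He subrr.
exists (e 0 - d 0) => // x.
have ced : continuous (fun x => e x - d x).
  by move=> y; apply: cvgB; [exact: ce|exact: cd].
by rewrite -(connected_int_const G_connected ced edint x 0) addrC subrK.
Qed.

(** By compactness [f] is uniformly continuous, so its increment by a small [u]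
    stays in the part of the circle where [centered] is continuous. *)
Lemma near0_lifts (eps : R) : 0 < eps ->
  \forall u \near 0, exists2 d, lifts u d & forall x, `|d x| < eps.
Proof.
move=> eps0; pose e : R := Num.min eps 2^-1.
have e0 : 0 < e by rewrite lt_min eps0 invr_gt0 ltr0n.
have : \forall u \near 0, [set: G] `<=` (fun x => `|centered (f (x + u) - f x)| < e).
  move/compact_near_coveringP : G_compact; apply=> x _.
  have : (f (z.1 + z.2) - f z.1) @[z --> (x, 0 : G)] --> f (x + 0) - f x.
    apply: tzmod_cvgB.
      apply: continuous_cvg; first exact: f_continuous.
      exact: (@add_continuous G (x, 0)).
    by apply: continuous_cvg; [exact: f_continuous|exact: cvg_fst].
  rewrite addr0 subrr => /cvg_circleP /(_ _ e0).
  by apply: filterS => z; rewrite subr0.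
apply: filterS => u Hu.
have {}Hu x : `|centered (f (x + u) - f x)| < e by exact: Hu.
exists (fun x => centered (f (x + u) - f x)); last first.
  by move=> x; apply: lt_le_trans (Hu x) _; rewrite ge_min lexx.
split=> [x|x]; last exact: centeredK.
apply: (@continuous_comp _ _ _ (fun x => f (x + u) - f x) (@centered R)).
  apply: tzmod_cvgB; last exact: f_continuous.
  by apply: (@continuous_comp _ _ _ (fun x => x + u) f);
    [apply: tzmod_cvgD; [exact: cvg_id|exact: cvg_cst]|exact: f_continuous].
by apply: centered_continuous; apply: lt_le_trans (Hu x) _; rewrite ge_min lexx orbT.
Qed.

(** The elements whose increment lifts form a subgroup, which is open by
    [near0_lifts]. *)
Lemma lifts_exist g : exists d, lifts g d.
Proof.
apply: (connected_open_subgroup G_connected (H := fun g => exists d, lifts g d)).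
  by apply: filterS (near0_lifts ltr01) => u [d ? _]; exists d.
move=> x y [d Hd] [e He]; eexists; exact: (liftsD Hd (liftsN He)).
Qed.

(** The bound is uniform in [g]: a nearby [g'] has a lift that differs from a
    translate of the given lift for [g] by a function bounded by 1, so the
    oscillation is locally bounded on the compact group. *)
Lemma lifts_oscillation :
  exists C, forall g d, lifts g d -> forall x y, `|d x - d y| <= C.
Proof.
pose P (C : R) g := forall d, lifts g d -> forall x y, `|d x - d y| <= C.
have : \forall C \near +oo, [set: G] `<=` P C.
  move/compact_near_coveringP : G_compact; apply=> g _.
  have [d0 Hd0] := lifts_exist g.
  have [B HB] := compact_bounded_fun G_compact Hd0.1.
  have Hnear := near_translate g (near0_lifts (ltr01 : 0 < 1 :> R)).
  near=> g' C.
  have hC : (B + B) + (1 + 1) <= C.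
    by near: C; apply: nbhs_pinfty_ge; exact: num_real.
  move=> d Hd x y.
  have [e He e1] : exists2 e, lifts (g' - g) e & forall x, `|e x| < 1.
    by near: g'; exact: Hnear.
  have := liftsD Hd0 He; rewrite addrC subrK => H.
  have [m _ Hm] := lifts_const H Hd.
  have -> : d x - d y = (d0 (x + (g' - g)) - d0 (y + (g' - g))) + (e x - e y).
    by rewrite !Hm; ring.
  apply: le_trans hC.
  apply: le_trans (ler_normD _ _) _; apply: lerD;
    by apply: le_trans (ler_normB _ _) _; apply: lerD => //; exact: ltW.
move=> /(@filter_ex _ (pinfty_nbhs R)) [C HC].
by exists C => g; exact: HC.
Unshelve. all: by end_near. Qed.

Definition birkhoff d g n x := \sum_(k < n) d (x + g *+ k).

Lemma birkhoffS d g n x : birkhoff d g n.+1 x = birkhoff d g n x + d (x + g *+ n).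
Proof. by rewrite /birkhoff big_ord_recr. Qed.

Lemma lifts_birkhoff g d n : lifts g d -> lifts (g *+ n) (birkhoff d g n).
Proof.
move=> Hd; elim: n => [|n IHn].
  rewrite mulr0n (_ : birkhoff d g 0 = fun=> 0); first exact: lifts0.
  by apply/funext => x; rewrite /birkhoff big_ord0.
have := liftsD Hd IHn; rewrite -mulrS; congr (lifts _ _).
by apply/funext => x; rewrite birkhoffS addrC.
Qed.

(** The difference [m] of the two sides is an integer constant. Summed over
    the base points [k * h] with [k < n], the left side telescopes and the right
    side becomes an increment of a Birkhoff sum, so [n * m] is a difference of two
    oscillations, which is bounded independently of [n]. *)
Lemma lifts_comm g h d e : lifts g d -> lifts h e ->
  forall x, d (x + h) - d x = e (x + g) - e x.
Proof.
move=> Hd He; have [C HC] := lifts_oscillation.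
have H1 := liftsD Hd He; have := liftsD He Hd; rewrite addrC => H2.
have [m _ Hm] := lifts_const H2 H1.
suff m0 : m = 0.
  by move=> x; have := Hm x; rewrite m0; lra.
have Hn n : n%:R * m = (d (h *+ n) - d 0) - (birkhoff e h n g - birkhoff e h n 0).
  elim: n => [|n IHn]; first by rewrite mul0r /birkhoff !big_ord0 mulr0n; ring.
  rewrite -natr1 mulrDl mul1r IHn !birkhoffS mulrSr add0r.
  by have := Hm (h *+ n); rewrite (addrC g); lra.
apply: (@bounded_multiples_eq0 _ _ (C + C)) => n.
rewrite -[n%:R]ger0_norm // -normrM Hn.
apply: le_trans (ler_normB _ _) _; apply: lerD; first exact: HC Hd _ _.
exact: HC (lifts_birkhoff n He) _ _.
Qed.

(** The number [c] is the asymptotic average of [d] along the multiples of [g].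
    Asking for a bounded error, rather than for a limit, makes additivity of
    slopes a matter of adding errors. *)
Definition slope g d c := exists B, forall n, `|birkhoff d g n 0 - n%:R * c| <= B.

Lemma slope_exists g d : lifts g d -> exists c, slope g d c.
Proof.
move=> Hd; have [C HC] := lifts_oscillation.
have [|c Hc] := @quasi_additive_slope _ (fun n => birkhoff d g n 0) C;
  last by exists c, C.
move=> m n.
have -> : birkhoff d g (m + n) 0 = birkhoff d g m 0 + birkhoff d g n (g *+ m).
  rewrite /birkhoff big_split_ord /=; congr (_ + _).
  by apply: eq_bigr => k _; rewrite add0r mulrnDr.
by rewrite (addrC (birkhoff d g m 0)) addrK; exact: HC (lifts_birkhoff n Hd) _ _.
Qed.

Lemma slope_unique g d c c' : slope g d c -> slope g d c' -> c = c'.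
Proof.
move=> [B HB] [B' HB']; apply/eqP; rewrite -subr_eq0; apply/eqP.
apply: (@bounded_multiples_eq0 _ _ (B' + B)) => n.
rewrite -[n%:R]ger0_norm // -normrM.
have -> : n%:R * (c - c') =
  (birkhoff d g n 0 - n%:R * c') - (birkhoff d g n 0 - n%:R * c) by ring.
by apply: le_trans (ler_normB _ _) _; apply: lerD.
Qed.

Lemma slope0 : slope 0 (fun=> 0) 0.
Proof.
by exists 0 => n; rewrite /birkhoff big1 // mulr0 subr0 normr0.
Qed.

(** The Birkhoff sums of the combined lift along [g + h] regroup, by [lifts_comm],
    into one sum along [g] and one along [h] with distinct base points, and the
    base points matter only up to [lifts_oscillation]. *)
Lemma slopeD g h d e c c' : lifts g d -> lifts h e -> slope g d c -> slope h e c' ->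
  slope (g + h) (fun x => d (x + h) + e x) (c + c').
Proof.
move=> Hd He [B HB] [B' HB']; have [C HC] := lifts_oscillation.
exists (C + B + B') => n.
have -> : birkhoff (fun x => d (x + h) + e x) (g + h) n 0 =
    birkhoff d g n (h *+ n) + birkhoff e h n 0.
  elim: n => [|n IHn]; first by rewrite /birkhoff !big_ord0 addr0.
  rewrite !birkhoffS IHn !add0r mulrSr mulrnDl.
  have := lifts_comm (lifts_birkhoff n Hd) He (h *+ n).
  rewrite -addrA (addrC (g *+ n)) addrAC -mulrSr => h1; rewrite addrA.
  have -> : h *+ n.+1 + g *+ n = h *+ n + h + g *+ n by rewrite mulrSr.
  by move: h1; rewrite mulrSr; lra.
have -> : birkhoff d g n (h *+ n) + birkhoff e h n 0 - n%:R * (c + c') =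
  (birkhoff d g n (h *+ n) - birkhoff d g n 0) + (birkhoff d g n 0 - n%:R * c)
  + (birkhoff e h n 0 - n%:R * c') by ring.
apply: le_trans (ler_normD _ _) _; apply: lerD => //.
apply: le_trans (ler_normD _ _) _; apply: lerD => //.
exact: HC (lifts_birkhoff n Hd) _ _.
Qed.

Lemma slope_shift g d c m : slope g d c -> slope g (fun x => d x + m) (c + m).
Proof.
move=> [B HB]; exists B => n.
rewrite /birkhoff big_split /= sumr_const card_ord.
rewrite (_ : _ - _ = birkhoff d g n 0 - n%:R * c) //.
by rewrite /birkhoff -[m *+ n]mulr_natl; ring.
Qed.

Lemma slope_le g d c (eps : R) :
  slope g d c -> (forall x, `|d x| <= eps) -> `|c| <= eps.
Proof.
move=> [B HB] Hd; rewrite leNgt; apply/negP => ce.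
suff /subr0_eq h : `|c| - eps = 0 by rewrite h ltxx in ce.
apply: (@bounded_multiples_eq0 _ _ B) => n.
have h0 : 0 <= `|c| - eps by rewrite subr_ge0 ltW.
rewrite ger0_norm // mulrBr.
have h1 : `|birkhoff d g n 0| <= n%:R * eps.
  apply: le_trans (ler_norm_sum _ _ _) _.
  apply: (@le_trans _ _ (\sum_(k < n) eps)); first by apply: ler_sum.
  by rewrite sumr_const card_ord mulr_natl.
have h2 : n%:R * `|c| = `|n%:R * c| by rewrite normrM ger0_norm.
have := lerB_dist (n%:R * c) (birkhoff d g n 0); rewrite distrC.
have := HB n.
by rewrite h2; move: h1; lra.
Qed.

(** Two lifts of the same increment differ by an integer, and so do their
    slopes; hence [chi g], the class of the slope, and [F g], the value at 0 of
    the lift minus its slope, do not depend on the lift chosen. *)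
Theorem character_decomposition :
  exists (chi : {additive G -> circle R}) (F : G -> R),
    [/\ continuous chi, continuous F, F 0 = 0 &
        forall x, f x = f 0 + chi x + to_circle (F x)].
Proof.
have /choice[dc Hdc] : forall g, exists dc : (G -> R) * R,
    lifts g dc.1 /\ slope g dc.1 dc.2.
  move=> g; have [d Hd] := lifts_exist g.
  by have [c Hc] := slope_exists Hd; exists (d, c).
pose D g := (dc g).1; pose S g := (dc g).2.
have HD g : lifts g (D g) by case: (Hdc g).
have HS g : slope g (D g) (S g) by case: (Hdc g).
have key g d c : lifts g d -> slope g d c ->
    exists2 m, m \is a Num.int & (d 0 = D g 0 + m /\ c = S g + m).
  move=> Hd Hc; have [m mi Hm] := lifts_const (HD g) Hd.
  exists m => //; split=> //; apply: (slope_unique Hc).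
  by have := slope_shift m (HS g); congr (slope _ _ _); apply/funext => x; rewrite Hm.
pose F g := D g 0 - S g.
(* This invariance allows [F] to be computed below with convenient lifts. *)
have keyF g d c : lifts g d -> slope g d c -> F g = d 0 - c.
  by move=> Hd Hc; have [m _ [-> ->]] := key _ _ _ Hd Hc; rewrite /F; ring.
pose chi g := to_circle (S g).
have chiD g h : chi (g + h) = chi g + chi h.
  have [m mi [_ Hm]] := key _ _ _ (liftsD (HD g) (HD h))
    (slopeD (HD g) (HD h) (HS g) (HS h)).
  rewrite /chi -raddfD Hm raddfD /=.
  by move: mi; rewrite -to_circle_eq0 => /eqP ->; rewrite addr0.
have chiB : zmod_morphism chi.
  by move=> g h; apply/eqP; rewrite -subr_eq opprK -chiD subrK.
have fE x : f x = f 0 + chi x + to_circle (F x).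
  have -> : f 0 + chi x + to_circle (F x) = f 0 + to_circle (D x 0).
    by rewrite -addrA -raddfD /F (addrC (S x)) subrK.
  by have := (HD x).2 0; rewrite add0r => ->; rewrite addrC subrK.
have cF : continuous F.
  move=> g; apply/cvgrPdist_le => eps eps0.
  have : \forall u \near 0, exists2 d, lifts u d & forall x, `|d x| < eps / 2.
    by apply: near0_lifts; rewrite divr_gt0.
  move=> /(near_translate g); apply: filterS => g' [d Hd d1].
  have [c Hc] := slope_exists Hd.
  have := keyF _ _ _ (liftsD Hd (HD g)) (slopeD Hd (HD g) Hc (HS g)).
  rewrite subrK add0r => ->.
  have -> : F g - (d g + D g 0 - (c + S g)) = c - d g by rewrite /F; ring.
  apply: le_trans (ler_normB _ _) _.
  rewrite [eps]splitr; apply: lerD; last exact: ltW.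
  by apply: (slope_le Hc) => x; exact: ltW.
have F0 : F 0 = 0 by rewrite (keyF _ _ _ lifts0 slope0) subr0.
have cchi : continuous chi.
  have -> : chi = fun x => f x - (f 0 + to_circle (F x)).
    apply/funext => x; apply/esym/eqP.
    by rewrite subr_eq {1}(fE x) addrA [chi x + _]addrC.
  move=> x; apply: tzmod_cvgB; first exact: f_continuous.
  apply: tzmod_cvgD; first exact: cvg_cst.
  apply: (@continuous_comp _ _ _ F (@to_circle R)); first exact: cF.
  exact: to_circle_continuous.
pose chi_mixin := GRing.isZmodMorphism.Build G (circle R) chi chiB.
pose chi' : {additive G -> circle R} := HB.pack chi chi_mixin.
by exists chi', F.
Qed.

End Decomposition.

(** A homomorphism with a real lift is trivial: by connectedness the lift is
    itself additive, and a bounded additive function vanishes. This is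
    the uniqueness of the character in [character_decomposition]. *)
Lemma morph_lift_eq0 (R : realType) (G : topologicalZmodType)
    (psi : G -> circle R) (K : G -> R) :
  compact [set: G] -> connected [set: G] -> {morph psi : x y / x + y} ->
  continuous K -> K 0 = 0 -> (forall x, psi x = to_circle (K x)) ->
  forall x, K x = 0.
Proof.
move=> cG kG psiD cK K0 psiE x.
have KD y z : K (z + y) = K z + K y.
  have := connected_int_const (k := fun z => K (z + y) - K z - K y) kG _ _ z 0.
  rewrite add0r K0 subr0 subrr => H.
  apply/eqP; rewrite -subr_eq0 opprD addrA H; first exact/eqP.
  - move=> u; apply: cvgB; last exact: cvg_cst.
    by apply: cvgB; [exact: translate_continuous|exact: cK].
  - by move=> u; rewrite -to_circle_eq0 !raddfB /= -!psiE psiD addrAC addrK subrr.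
have [B KB] := compact_bounded_fun cG cK.
have Kn n : K (x *+ n) = n%:R * K x.
  elim: n => [|n IHn]; first by rewrite mulr0n K0 mul0r.
  by rewrite mulrSr KD IHn -natr1 mulrDl mul1r.
apply: (bounded_multiples_eq0 (B := B)) => n.
by rewrite -[n%:R]ger0_norm // -normrM -Kn.
Qed.

(** * The solenoid as a compact connected group *)

Section Pointwise.
Variables (I : Type) (V : topologicalType).

Lemma cvg_ptws (T : Type) (F : set_system T) (f : T -> {ptws I -> V})
    (a : {ptws I -> V}) : Filter F ->
  (forall i, f x i @[x --> F] --> a i) -> f @ F --> a.
Proof.
move=> FF H; apply/cvg_sup => i A [_ [[C oC <-] Ca CA]].
apply: (filterS (P := f @^-1` [set g | C (g i)])); first by move=> x /CA.
exact: (H i C (open_nbhs_nbhs _)).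
Qed.

Lemma continuous_ptws (X : topologicalType) (f : X -> {ptws I -> V}) :
  (forall i, continuous (fun x => f x i)) -> continuous f.
Proof. by move=> H x; apply: cvg_ptws => i; exact: H. Qed.

Lemma eval_ptws_continuous (i : I) : continuous (fun f : {ptws I -> V} => f i).
Proof.
move=> f A Ai; have /cvg_sup/(_ i) : f --> f by exact: cvg_id.
by apply; apply: (initial_continuous (f := fun f : I -> V => f i)).
Qed.

Lemma continuous_eval (X : topologicalType) (f : X -> {ptws I -> V}) (i : I) :
  continuous f -> continuous (fun x => f x i).
Proof.
move=> cf x; apply: (@continuous_comp _ _ _ f (fun g : {ptws I -> V} => g i)).
  exact: cf.
exact: eval_ptws_continuous.
Qed.

Lemma compact_ptws : compact [set: V] -> compact [set: {ptws I -> V}].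
Proof.
move=> cV; have := @tychonoff {classic I} (fun=> V) (fun=> setT) (fun=> cV).
by congr (compact _); apply/seteqP; split.
Qed.

End Pointwise.

Section BondContinuity.

Lemma tzmod_cvg_sum (T : Type) (F : set_system T) (V : topologicalZmodType)
    (n : nat) (f : T -> 'I_n -> V) (a : 'I_n -> V) : Filter F ->
  (forall i, f x i @[x --> F] --> a i) ->
  (\sum_i f x i) @[x --> F] --> \sum_i a i.
Proof.
move=> FF H; elim: n f a H => [|n IHn] f a H.
  by rewrite big_ord0; under eq_cvg do rewrite big_ord0; exact: cvg_cst.
rewrite big_ord_recl; under eq_cvg do rewrite big_ord_recl.
by apply: tzmod_cvgD => //; apply: IHn => i.
Qed.

Lemma tzmod_cvgMz (T : Type) (F : set_system T) (V : topologicalZmodType)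
    (f : T -> V) (a : V) (m : int) : Filter F ->
  f @ F --> a -> (f x *~ m) @[x --> F] --> a *~ m.
Proof.
move=> FF fa.
have fan n : (f x *+ n) @[x --> F] --> a *+ n.
  elim: n => [|n IHn]; first exact: cvg_cst.
  by rewrite mulrS; under eq_cvg do rewrite mulrS; exact: tzmod_cvgD.
case: m => n; first exact: fan.
apply: continuous_cvg; last exact: fan.
exact: opp_continuous.
Qed.

Lemma bond_cvg (T : Type) (F : set_system T) (V : topologicalZmodType)
    (kappa : dimension) (m : bonding kappa) (f : T -> idx kappa -> V)
    (a : idx kappa -> V) : Filter F ->
  (forall k, f x k @[x --> F] --> a k) ->
  forall k, bond m (f x) k @[x --> F] --> bond m a k.
Proof.
move=> FF; case: kappa m f a => [n|] m f a H k /=.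
  by apply: tzmod_cvg_sum => i; exact: tzmod_cvgMz.
rewrite /times_id; case: insub => [i|]; last exact: H.
by apply: tzmod_cvg_sum => j; exact: tzmod_cvgMz.
Qed.

Lemma tzmod_continuousB (X : topologicalType) (V : topologicalZmodType)
  (f g : X -> V) : continuous f -> continuous g -> continuous (fun x => f x - g x).
Proof. by move=> cf cg x; apply: tzmod_cvgB; [exact: cf|exact: cg]. Qed.

Lemma continuous_bond (X : topologicalType) (V : topologicalZmodType)
    (kappa : dimension) (m : bonding kappa) (f : X -> idx kappa -> V) :
  (forall k, continuous (fun x => f x k)) ->
  forall k, continuous (fun x => bond m (f x) k).
Proof. by move=> cf k x; apply: bond_cvg => l; exact: cf. Qed.

Lemma bond_inv_cvg (T : Type) (F : set_system T) (R : realType)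
    (kappa : dimension) (m : bonding kappa) (f : T -> idx kappa -> R)
    (a : idx kappa -> R) : Filter F ->
  (forall k, f x k @[x --> F] --> a k) ->
  forall k, bond_inv m (f x) k @[x --> F] --> bond_inv m a k.
Proof.
move=> FF; case: kappa m f a => [n|] m f a H k /=.
  by apply: tzmod_cvg_sum => i; apply: cvgM; [exact: cvg_cst|exact: H].
rewrite /times_id; case: insub => [i|]; last exact: H.
by apply: tzmod_cvg_sum => j; apply: cvgM; [exact: cvg_cst|exact: H].
Qed.

End BondContinuity.

Section SolenoidGroup.
Variables (R : realType) (kappa : dimension) (M : nat -> bonding kappa).
Local Notation S := (solenoid R M).
Local Notation V := (idx kappa -> R).

(** The coordinates of a solenoid in the individual circles; they are characters
    that determine both the points and the topology. *)
Definition component (j : nat) (k : idx kappa) (x : S) : circle R := coords x j k.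

Lemma component_is_zmod_morphism j k : zmod_morphism (component j k).
Proof. by []. Qed.

HB.instance Definition _ j k :=
  GRing.isZmodMorphism.Build S (circle R) (component j k)
    (component_is_zmod_morphism j k).

Lemma component_inj (x y : S) : (forall j k, component j k x = component j k y) -> x = y.
Proof.
by move=> H; apply: val_inj; apply/funext => j; apply/funext => k; exact: H.
Qed.

Lemma component_bond (x : S) j :
  (fun k => component j k x) = bond (M j) (fun k => component j.+1 k x).
Proof. by have /asboolP := coordsP x; exact. Qed.

Lemma cvg_component (T : Type) (F : set_system T) (f : T -> S) (a : S) : Filter F ->
  (forall j k, component j k (f x) @[x --> F] --> component j k a) -> f @ F --> a.
Proof.
move=> FF H A [_ [[C oC <-] Ca CA]].
apply: (filterS (P := f @^-1` [set y | C (coords y)])); first by move=> x /CA.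
have : coords (f x) @[x --> F] --> coords a.
  apply: cvg_ptws => j; apply: (@cvg_ptws _ _ _ _ (fun x => coords (f x) j)) => k.
  exact: H.
by apply; exact: open_nbhs_nbhs.
Qed.

Lemma continuous_component (X : topologicalType) (f : X -> S) :
  (forall j k, continuous (fun x => component j k (f x))) -> continuous f.
Proof. by move=> H x; apply: cvg_component => j k; exact: H. Qed.

Lemma component_continuous j k : continuous (component j k).
Proof.
move=> x; apply: (@continuous_comp _ _ _ (@coords R kappa M)
  (fun t : tower R kappa => t j k)).
  exact: initial_continuous.
apply: (@continuous_comp _ _ _ (fun t : tower R kappa => t j)
  (fun u : torus R kappa => u k)).
  exact: eval_ptws_continuous.
exact: eval_ptws_continuous.
Qed.

Lemma solenoid_sub_continuous : continuous (fun z : S * S => z.1 - z.2).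
Proof.
move=> [x y]; apply: cvg_component => j k.
apply: (@tzmod_cvgB _ _ _ (fun z : S * S => component j k z.1)
  (fun z : S * S => component j k z.2)).
  by apply: continuous_cvg; [exact: component_continuous|exact: cvg_fst].
by apply: continuous_cvg; [exact: component_continuous|exact: cvg_snd].
Qed.

HB.instance Definition _ :=
  PreTopologicalNmodule_isTopologicalZmodule.Build S solenoid_sub_continuous.

Lemma circle_closed0 : closed [set (0 : circle R)].
Proof.
rewrite -openC openE => p /= p0; apply/nbhs_circleP; exists `|centered p|.
  by rewrite normr_gt0 centered_eq0; apply/eqP.
by move=> q + q0; rewrite q0 sub0r norm_centeredN ltxx.
Qed.

Lemma inverse_limit_closed :
  closed [set t : tower R kappa | t \in @inverse_limit R kappa M].
Proof.
pose d j k (t : tower R kappa) := t j k - bond (M j) (t j.+1) k.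
have -> : [set t : tower R kappa | t \in @inverse_limit R kappa M] =
    \bigcap_j \bigcap_k (d j k @^-1` [set 0]).
  apply/seteqP; split=> [t /asboolP tM j _ k _ | t tM] /=.
    by rewrite /d {1}tM subrr.
  apply/asboolP => j; apply/funext => k.
  by apply/eqP; rewrite -subr_eq0; apply/eqP; exact: (tM j I k I).
have ct i l : continuous (fun t : tower R kappa => t i l).
  move=> t; apply: (@continuous_comp _ _ _ (fun t : tower R kappa => t i)
    (fun u : torus R kappa => u l));
  exact: eval_ptws_continuous.
have cd j k : continuous (d j k).
  apply: tzmod_continuousB; first exact: ct.
  by apply: continuous_bond => l; exact: ct.
apply: closed_bigI => j _; apply: closed_bigI => k _.
apply: closed_comp; last exact: circle_closed0.
by move=> t _; exact: cd.
Qed.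

Lemma solenoid_compact : compact [set: S].
Proof.
have cK : compact [set t : tower R kappa | t \in @inverse_limit R kappa M].
  have cT : compact [set: tower R kappa].
    exact: compact_ptws (compact_ptws (@circle_compact R)).
  exact: subclosed_compact inverse_limit_closed cT _.
move=> F PF _.
have [|t [tM tF]] := cK (@coords R kappa M @ F) _.
  have H x : @coords R kappa M x \in @inverse_limit R kappa M by exact: coordsP.
  by apply: (@filterS _ F _ setT) => [x _|]; [exact: H|exact: filterT].
exists (Solenoid tM); split=> // A B FA [_ [[C oC <-] Ca CB]].
have [_ [[x Ax <-] Cx]] : (@coords R kappa M @` A) `&` C !=set0.
  apply: tF; last exact: open_nbhs_nbhs.
  by apply: (@filterS _ F _ A) => // x Ax; exists x.
by exists x; split=> //; exact: CB.
Qed.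

Lemma bond_invB (m : bonding kappa) (s t : V) :
  bond_inv m (s - t) = bond_inv m s - bond_inv m t.
Proof. by apply: (can_inj (@bondK R _ m)); rewrite bondB !bond_invK. Qed.

Lemma unwindB (s t : V) j : unwind M (s - t) j = unwind M s j - unwind M t j.
Proof. by elim: j => [//|j IHj] /=; rewrite IHj bond_invB. Qed.

Lemma component_to_solenoid j k (t : V) :
  component j k (to_solenoid M t) = to_circle (unwind M t j k).
Proof. by []. Qed.

Lemma to_solenoid_is_zmod_morphism : zmod_morphism (@to_solenoid R kappa M).
Proof.
move=> s t; apply: component_inj => j k.
rewrite raddfB !component_to_solenoid unwindB.
exact: (raddfB (@to_circle R)) (unwind M s j k) (unwind M t j k).
Qed.

HB.instance Definition _ := GRing.isZmodMorphism.Build V S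
  (@to_solenoid R kappa M) to_solenoid_is_zmod_morphism.

Lemma unwind_cvg (T : Type) (F : set_system T) (f : T -> V) (a : V) j : Filter F ->
  (forall k, f x k @[x --> F] --> a k) ->
  forall k, unwind M (f x) j k @[x --> F] --> unwind M a j k.
Proof. by move=> FF H; elim: j => //= j IHj; exact: bond_inv_cvg. Qed.

Lemma to_solenoid_cvg (T : Type) (F : set_system T) (f : T -> V) (a : V) : Filter F ->
  (forall k, f x k @[x --> F] --> a k) ->
  to_solenoid M (f x) @[x --> F] --> to_solenoid M a.
Proof.
move=> FF H; apply: cvg_component => j k.
by apply: cvg_to_circle; exact: unwind_cvg.
Qed.

Fixpoint rewind (t : V) (j : nat) : V :=
  if j is j'.+1 then rewind (bond (M j') t) j' else t.

Lemma rewindK t j : unwind M (rewind t j) j = t.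
Proof. by elim: j t => //= j IHj t; rewrite IHj bondK. Qed.

(** Given a point [x], some vector [v n] has an image that agrees with [x] in
    the coordinate torus of index [n], hence in all the earlier ones too. *)
Lemma to_solenoid_dense (x : S) : closure (range (@to_solenoid R kappa M)) x.
Proof.
pose v n := rewind (fun k => centered (component n k x)) n.
have down n d y : component (n + d) ^~ y = component (n + d) ^~ x ->
    component n ^~ y = component n ^~ x.
  elim: d => [|d IHd]; first by rewrite addn0.
  by rewrite addnS => H; apply: IHd; rewrite component_bond H -component_bond.
have vx n d k : component n k (to_solenoid M (v (n + d)%N)) = component n k x.
  suff H : component n ^~ (to_solenoid M (v (n + d)%N)) = component n ^~ x.
    exact: (congr1 (@^~ k) H).
  apply: (down n d); apply/funext => l.
  by rewrite component_to_solenoid rewindK centeredK.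
have vcvg : to_solenoid M (v n) @[n --> \oo] --> x.
  apply: cvg_component => j k; apply: cvg_near_cst.
  by exists j => // n /= jn; have := vx j (n - j)%N k; rewrite subnKC.
apply: (closed_cvg (closure (range (@to_solenoid R kappa M))) _ _ _ vcvg).
  exact: closed_closure.
by near=> n; apply: subset_closure; exists (v n).
Unshelve. all: by end_near. Qed.

(** The dense image of the vector space is a union of connected lines through 0. *)
Lemma solenoid_connected : connected [set: S].
Proof.
have -> : [set: S] = closure (range (@to_solenoid R kappa M)).
  by apply/seteqP; split=> // x _; exact: to_solenoid_dense.
apply: connected_closure.
have -> : range (@to_solenoid R kappa M) =
    \bigcup_(v in [set: V]) range (fun t : R => to_solenoid M (t *: v)).
  apply/seteqP; split=> [_ [v _ <-]|_ [v _ [t _ <-]]]; last by exists (t *: v).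
  by exists v => //; exists 1 => //; rewrite scale1r.
apply: bigcup_connected.
  by exists 0 => v _; exists 0 => //; rewrite scale0r raddf0.
move=> v _; apply: connected_continuous_connected.
  by apply/connected_intervalP.
apply: continuous_subspaceT => t; apply: to_solenoid_cvg => k.
by apply: cvgM; [exact: cvg_id|exact: cvg_cst].
Qed.

End SolenoidGroup.

(** * Lifting homomorphisms to the covering vector space *)

(** A homomorphism from a vector space to the circle lifts to an additive real
    function as soon as its values along [2^-n v] eventually stay small: there
    the representatives double exactly when the vector does, so the numbers
    [2^n * centered (chi (2^-n v))] are eventually constant, and their common
    value is additive in [v]. *)
Section HalvingLift.
Variables (R : realType) (V : lmodType R) (chi : {additive V -> circle R}).

Definition halved (n : nat) (v : V) : V := (2 ^- n) *: v.

(** Below 1/4, doubling a point of the circle doubles its representative. *)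
Definition small_from (v : V) (n : nat) :=
  forall m, (n <= m)%N -> `|centered (chi (halved m v))| < 4^-1.

Lemma halvedD n u v : halved n (u + v) = halved n u + halved n v.
Proof. exact: scalerDr. Qed.

Lemma halvedS n v : halved n v = halved n.+1 v + halved n.+1 v.
Proof.
rewrite /halved -scalerDl; congr (_ *: _).
by rewrite exprS invfM; field; rewrite expf_neq0 // pnatr_eq0.
Qed.

Definition scaled_up n v := 2 ^+ n * centered (chi (halved n v)).

Lemma scaled_up_eq v n m : small_from v n -> (n <= m)%N ->
  scaled_up m v = scaled_up n v.
Proof.
move=> sv /subnKC <-; elim: (m - n)%N => [|d IHd]; first by rewrite addn0.
rewrite -IHd addnS /scaled_up [in RHS]halvedS raddfD /= centeredD.
  by rewrite exprSr; ring.
by have := sv (n + d).+1 (leqW (leq_addr _ _)); lra.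
Qed.

Lemma to_circle_scaled_up n v : to_circle (scaled_up n v) = chi v.
Proof.
elim: n => [|n IHn].
  by rewrite /scaled_up /halved expr0 invr1 mul1r scale1r centeredK.
rewrite -IHn /scaled_up.
have H m u : to_circle (2 ^+ m * centered (chi u)) = chi u *+ 2 ^ m.
  by rewrite -natrX mulr_natl raddfMn /= centeredK.
by rewrite !H [in RHS]halvedS raddfD /= expnS mulnC mulrnA mulr2n mulrnDl.
Qed.

Hypothesis chi_small : forall v, exists n, small_from v n.

Definition lift_at v := scaled_up (xget 0%N (small_from v)) v.

Lemma lift_atE v n : small_from v n -> lift_at v = scaled_up n v.
Proof.
move=> sv; have sN : small_from v (xget 0%N (small_from v)).
  by have [m sm] := chi_small v; exact: xgetPex (ex_intro _ m sm).
rewrite /lift_at; set N := xget _ _ in sN *.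
rewrite -(scaled_up_eq sN (leq_maxl N n)).
by rewrite (scaled_up_eq sv (leq_maxr N n)).
Qed.

Lemma lift_atK v : to_circle (lift_at v) = chi v.
Proof. exact: to_circle_scaled_up. Qed.

Lemma lift_atD u v : lift_at (u + v) = lift_at u + lift_at v.
Proof.
have [n1 s1] := chi_small u; have [n2 s2] := chi_small v.
have [n3 s3] := chi_small (u + v).
pose n := (n1 + n2 + n3)%N.
have mono w k : small_from w k -> (k <= n)%N -> small_from w n.
  by move=> sk kn m nm; apply: sk; exact: leq_trans nm.
have {}s1 : small_from u n by apply: mono s1 _; rewrite /n -addnA leq_addr.
have {}s2 : small_from v n by apply: mono s2 _; rewrite /n addnAC leq_addl.
have {}s3 : small_from (u + v) n by apply: mono s3 _; rewrite /n leq_addl.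
rewrite (lift_atE s1) (lift_atE s2) (lift_atE s3) /scaled_up halvedD raddfD /=.
rewrite centeredD ?mulrDr //.
by have := s1 n (leqnn n); have := s2 n (leqnn n); lra.
Qed.

End HalvingLift.

(** Divisibility of the vector space: the value at [v] is divisible by every
    positive integer. *)
Lemma additive_int_eq0 (R : realType) (V : lmodType R) (e : V -> R) :
  {morph e : x y / x + y} -> (forall v, e v \is a Num.int) -> forall v, e v = 0.
Proof.
move=> eD eint v.
have eM n u : e (u *+ n.+1) = n.+1%:R * e u.
  elim: n => [|n IHn]; first by rewrite mul1r.
  by rewrite mulrSr eD IHn -[n.+2%:R]natr1 mulrDl mul1r.
pose n := Num.Def.truncn `|e v|.
have E : e v = n.+1%:R * e (n.+1%:R^-1 *: v).
  by rewrite -eM -scaler_nat scalerA mulfV ?scale1r // pnatr_eq0.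
suff e0 : e (n.+1%:R^-1 *: v) = 0 by rewrite E e0 mulr0.
apply: int_lt1_eq0 => //.
have := truncnS_gt `|e v|; rewrite {1}E normrM ger0_norm //.
by rewrite gtr_pMr // ltr0n.
Qed.

(** * Self-maps of a solenoid *)

Section SelfMaps.
Variables (R : realType) (kappa : dimension) (M : nat -> bonding kappa).
Local Notation S := (solenoid R M).
Local Notation V := (idx kappa -> R).
Local Notation E := {ptws idx kappa -> R}.

Lemma bond0 (W : zmodType) (m : bonding kappa) : bond m (0 : idx kappa -> W) = 0.
Proof. by rewrite -[X in bond _ X](subrr (0 : idx kappa -> W)) bondB subrr. Qed.

Lemma bondD (W : zmodType) (m : bonding kappa) (x y : idx kappa -> W) :
  bond m (x + y) = bond m x + bond m y.
Proof. by rewrite -[y in LHS]opprK bondB -[- y]sub0r bondB bond0 sub0r opprK. Qed.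

Lemma unwindE (P : nat -> V) :
  (forall j, P j = bond (M j) (P j.+1)) -> forall j, unwind M (P 0%N) j = P j.
Proof. by move=> H; elim=> [//|j IHj] /=; rewrite IHj H bondK. Qed.

(** Decompose every coordinate of [h] into a character and a real function. By
    uniqueness of the character ([morph_lift_eq0]) both families are compatible
    with the bonding maps: the characters then assemble into [a], and the real
    functions are the [unwind]ings of those at level 0, which form [F]. *)
Theorem solenoid_map_decomposition (h : S -> S) : continuous h -> h 0 = 0 ->
  exists (a : {additive S -> S}) (F : S -> E),
    [/\ continuous a, continuous F, F 0 = 0 & forall x, h x = a x + to_solenoid M (F x)].
Proof.
move=> ch h0.
have cG := @solenoid_compact R kappa M; have kG := @solenoid_connected R kappa M.
have D jk : exists cP : {additive S -> circle R} * (S -> R),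
    [/\ continuous cP.1, continuous cP.2, cP.2 0 = 0 &
      forall x, component jk.1 jk.2 (h x) = cP.1 x + to_circle (cP.2 x)].
  have cjk : continuous (component jk.1 jk.2 \o h).
    by move=> x; apply: continuous_comp; [exact: ch|exact: component_continuous].
  have [chi [P [cchi cP P0 H]]] := character_decomposition cG kG cjk.
  exists (chi, P); split=> // x.
  by rewrite -[LHS]/((component jk.1 jk.2 \o h) x) H /= h0 raddf0 add0r.
have [chi [P [cchi cP P0 hE]]] : exists
    (chi : nat -> idx kappa -> {additive S -> circle R})
    (P : nat -> idx kappa -> S -> R),
    [/\ forall j k, continuous (chi j k), forall j k, continuous (P j k),
      forall j k, P j k 0 = 0 &
      forall j k x, component j k (h x) = chi j k x + to_circle (P j k x)].
  have {D} /choice[D HD] := D.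
  exists (fun j k => (D (j, k)).1), (fun j k => (D (j, k)).2).
  by split=> j k; have [] := HD (j, k).
pose K j k x := P j k x - bond (M j) (P j.+1 ^~ x) k.
pose psi j k x := bond (M j) (fun l => chi j.+1 l x) k - chi j k x.
have psiK j k x : psi j k x = to_circle (K j k x).
  have := congr1 (@^~ k) (component_bond (h x) j) => /=.
  rewrite hE (_ : component j.+1 ^~ (h x) =
    (fun l => chi j.+1 l x) + (@to_circle R \o (P j.+1 ^~ x))); last first.
    by apply/funext => l; rewrite hE.
  rewrite bondD bond_morph => H; rewrite /psi /K raddfB /=.
  apply/eqP; rewrite subr_eq addrAC eq_sym subr_eq addrC; apply/eqP.
  by rewrite H.
have psiD j k : {morph psi j k : x y / x + y}.
  move=> x y; rewrite /psi raddfD /=.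
  rewrite (_ : (fun l => chi j.+1 l (x + y)) =
    (fun l => chi j.+1 l x) + (fun l => chi j.+1 l y)); last first.
    by apply/funext => l; rewrite raddfD.
  by rewrite bondD opprD addrACA.
have K0 j k x : K j k x = 0.
  apply: (morph_lift_eq0 cG kG (psiD j k)) x => //.
    apply: tzmod_continuousB; first exact: cP.
    by apply: continuous_bond => l; exact: cP.
  rewrite /K P0 (_ : P j.+1 ^~ 0 = 0); last by apply/funext => l; exact: P0.
  by rewrite bond0 subr0.
have PE j x : P j ^~ x = bond (M j) (P j.+1 ^~ x).
  by apply/funext => k; apply/eqP; rewrite -subr_eq0; apply/eqP; exact: K0.
have aP x : ((fun j k => chi j k x) : tower R kappa) \in @inverse_limit R kappa M.
  apply/asboolP => j; apply/funext => k; apply/esym/eqP; rewrite -subr_eq0; apply/eqP.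
  by have := psiK j k x; rewrite K0 raddf0.
have [a aE] : exists a : {additive S -> S}, forall j k x, component j k (a x) = chi j k x.
  pose a0 x := Solenoid (aP x).
  have a0B : zmod_morphism a0.
    by move=> x y; apply: component_inj => j k; exact: raddfB.
  pose am := GRing.isZmodMorphism.Build S S a0 a0B.
  by exists (HB.pack a0 am : {additive S -> S}).
exists a, (fun x => P 0%N ^~ x); split.
- apply: continuous_component => j k.
  by rewrite (_ : (fun x => _) = chi j k) //; apply/funext => x; exact: aE.
- by apply: continuous_ptws => k; exact: cP.
- by apply/funext => k; exact: P0.
- move=> x; apply: component_inj => j k.
  have PU := unwindE (fun i => PE i x) j.
  by rewrite hE [RHS]raddfD /= aE PU.
Qed.

(** Each coordinate of [a] along the dense vector subgroup is lifted by halving;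
    the lifts at different levels are compatible with the bonding maps because
    their defect is additive and integer-valued. *)
Theorem solenoid_endomorphism_lift (a : {additive S -> S}) : continuous a ->
  exists A : {additive V -> V},
    continuous (A : E -> E) /\ forall v, a (to_solenoid M v) = to_solenoid M (A v).
Proof.
move=> ca.
have [ch chE] : exists ch : nat -> idx kappa -> {additive V -> circle R},
    forall j k v, ch j k v = component j k (a (to_solenoid M v)).
  pose chi j k (v : V) := component j k (a (to_solenoid M v)).
  have chiB j k : zmod_morphism (chi j k) by move=> u v; rewrite /chi !raddfB.
  pose chim j k := GRing.isZmodMorphism.Build V (circle R) (chi j k) (chiB j k).
  by exists (fun j k => HB.pack (chi j k) (chim j k) : {additive V -> circle R}).
have ch_cvg (T : Type) (F : set_system T) (f : T -> V) (v : V) j k : Filter F ->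
    (forall l, f x l @[x --> F] --> v l) -> ch j k (f x) @[x --> F] --> ch j k v.
  move=> FF H; rewrite chE; under eq_cvg do rewrite chE.
  apply: (cvg_comp (fun x => to_solenoid M (f x)) (fun y => component j k (a y))).
    exact: to_solenoid_cvg H.
  by apply: continuous_comp; [exact: ca|exact: component_continuous].
have near_small (v : E) j k : \forall u \near v & n \near \oo,
    `|centered (ch j k (halved n u))| < 4^-1.
  (* Letting the vector and the number of halvings vary together makes the
     smallness uniform in a neighbourhood of [v]. *)
  pose f (z : E * nat) : V := halved z.2 (z.1 : V).
  pose F : set_system (E * nat) := filter_prod (nbhs v) \oo.
  have FF : Filter F by exact: filter_prod_filter.
  have fcvg : ch j k (f z) @[z --> F] --> ch j k 0.
    have := @ch_cvg (E * nat)%type F f 0 j k FF.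
    apply => l.
    rewrite /f /halved (_ : (0 : V) l = 0 * v l); last by rewrite mul0r.
    apply: (@cvgM _ _ _ _ (fun z : E * nat => 2 ^- z.2) (fun z : E * nat => z.1 l)).
      apply: (cvg_comp snd (fun n : nat => (2 ^- n : R))); first exact: cvg_snd.
      under eq_cvg do rewrite -exprVn.
      by apply: cvg_expr; rewrite ger0_norm ?invr_ge0 // invf_lt1 // ltr1n.
    apply: (cvg_comp fst (fun u : E => u l)); first exact: cvg_fst.
    exact: eval_ptws_continuous.
  rewrite (raddf0 (ch j k)) in fcvg.
  have q0 : (0 : R) < 4^-1 by rewrite invr_gt0.
  have := iffLR (@cvg_circleP R _ F (fun z => ch j k (f z)) 0 FF) fcvg _ q0.
  by apply: filterS => z; rewrite subr0.
have small j k v : exists n, small_from (ch j k) v n.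
  have [[U N] [/= Uv [n _ Nn]] UN] := near_small v j k.
  by exists n => m nm; apply: (UN (v, m)); split; [exact: nbhs_singleton|exact: Nn].
pose L j k := lift_at (ch j k).
have LE j k v : to_circle (L j k v) = component j k (a (to_solenoid M v)).
  by rewrite -chE; exact: lift_atK.
have LD j k : {morph L j k : u v / u + v} by exact: lift_atD.
have cL j k : continuous (L j k : E -> R).
  move=> v; have [[U N] [/= Uv [n _ Nn]] UN] := near_small v j k.
  have sU u : U u -> small_from (ch j k) u n.
    by move=> Uu m nm; apply: (UN (u, m)); split; [exact: Uu|exact: Nn].
  have sv := sU v (nbhs_singleton Uv).
  (* Near [v] one and the same [n] computes the lift, which is therefore a
     composition of continuous maps there. *)
  pose hv (u : E) : V := halved n (u : V).
  have hcvg : ch j k (hv u) @[u --> v] --> ch j k (hv v).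
    apply: (@ch_cvg E (nbhs v) hv (hv v) j k) => l.
    apply: (@cvgM _ _ _ _ (fun=> 2 ^- n) (fun u : E => u l)); first exact: cvg_cst.
    exact: eval_ptws_continuous.
  have ccvg : centered (ch j k (hv u)) @[u --> v] --> centered (ch j k (hv v)).
    apply: continuous_cvg hcvg.
    by apply: centered_continuous; apply: lt_trans (sv n (leqnn n)) _; lra.
  have vcvg : 2 ^+ n * centered (ch j k (hv u)) @[u --> v] -->
      2 ^+ n * centered (ch j k (hv v)).
    by apply: cvgM ccvg; exact: cvg_cst.
  have Lv u : small_from (ch j k) u n -> L j k u = 2 ^+ n * centered (ch j k (hv u)).
    by move=> su; rewrite /L (lift_atE (small j k) su).
  have Lnear : \forall u \near v, 2 ^+ n * centered (ch j k (hv u)) = L j k u.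
    by apply: filterS Uv => u /sU /Lv ->.
  rewrite /continuous_at (Lv _ sv).
  have FF : Filter (nbhs v) by exact: nbhs_filter.
  exact: (cvg_trans (@near_eq_cvg _ _ (nbhs v) FF
    (fun u => 2 ^+ n * centered (ch j k (hv u))) (L j k) Lnear) vcvg).
have LB j (v : V) : L j ^~ v = bond (M j) (L j.+1 ^~ v).
  apply/funext => k; apply/eqP; rewrite -subr_eq0; apply/eqP.
  apply: (additive_int_eq0 (e := fun v => L j k v - bond (M j) (L j.+1 ^~ v) k)) v.
    move=> u v; rewrite LD.
    rewrite (_ : L j.+1 ^~ (u + v) = L j.+1 ^~ u + L j.+1 ^~ v); last first.
      by apply/funext => l; rewrite LD.
    by rewrite bondD opprD addrACA.
  move=> v; rewrite -to_circle_eq0 raddfB /= LE.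
  have := congr1 (@^~ k) (bond_morph (@to_circle R) (M j) (L j.+1 ^~ v)) => /= <-.
  rewrite (_ : to_circle (R:=R) \o L j.+1 ^~ v = component j.+1 ^~ (a (to_solenoid M v))).
    by rewrite -component_bond subrr.
  by apply/funext => l /=; rewrite LE.
have [A AE] : exists A : {additive V -> V}, forall v, A v = L 0%N ^~ v.
  pose A0 (v : V) : V := L 0%N ^~ v.
  have A0B : zmod_morphism A0.
    move=> u v; apply/funext => k; apply/eqP; rewrite eq_sym subr_eq; apply/eqP.
    by rewrite -LD subrK.
  pose Am := GRing.isZmodMorphism.Build V V A0 A0B.
  by exists (HB.pack A0 Am : {additive V -> V}).
exists A; split=> [|v].
  apply: continuous_ptws => k.
  by rewrite (_ : (fun v => _) = L 0%N k) //; apply/funext => v; rewrite AE.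
apply: component_inj => j k.
by rewrite component_to_solenoid AE (unwindE (fun i => LB i v)) LE.
Qed.

End SelfMaps.

(** * Rigidity of linear flows *)

Lemma neq0_component (R : realType) (I : Type) (v : I -> R) :
  v <> 0 -> exists k, v k != 0.
Proof.
move=> v0; apply: contrapT => H; apply: v0; apply/funext => k.
by apply/eqP/negPn/negP => vk; apply: H; exists k.
Qed.

(** An additive path that stays at bounded distance from a reparametrized line
    runs in that line: the multiples of [v k * L t l - v l * L t k] are bounded.
    The coefficient is then additive, and it is nonnegative since [n * beta t]
    is within a bounded distance of [gamma (n * t)]. *)
Lemma asymptotic_direction (R : realType) (I : Type) (L : R -> I -> R)
    (v : I -> R) (gamma : R -> R) :
  zmod_morphism L -> v <> 0 ->
  (forall k, exists B, forall t, `|gamma t * v k - L t k| <= B) ->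
  exists beta : {additive R -> R}, [/\ forall t, L t = beta t *: v,
    exists k c, forall t, beta t = L t k * c &
    (forall t, 0 < t -> 0 <= gamma t) -> forall t, 0 < t -> 0 <= beta t].
Proof.
move=> LB v0 bnd; have [k vk] := neq0_component v0.
have L0 : L 0 = 0 by rewrite -(subrr (0 : R)) LB subrr.
have LD s t : L (s + t) = L s + L t.
  by rewrite -{1}(opprK t) LB -[- t]sub0r LB L0 sub0r opprK.
have Ln n t l : L (t *+ n) l = n%:R * L t l.
  elim: n => [|n IHn]; first by rewrite mulr0n L0 mul0r.
  by rewrite mulrSr LD -natr1 mulrDl mul1r -IHn.
have prop t l : v k * L t l = v l * L t k.
  have [Bk Hk] := bnd k; have [Bl Hl] := bnd l.
  apply/eqP; rewrite -subr_eq0; apply/eqP.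
  apply: (bounded_multiples_eq0 (B := `|v l| * Bk + `|v k| * Bl)) => n.
  rewrite -[n%:R]ger0_norm // -normrM.
  have -> : n%:R * (v k * L t l - v l * L t k) =
      v l * (gamma (t *+ n) * v k - L (t *+ n) k) -
      v k * (gamma (t *+ n) * v l - L (t *+ n) l).
    by rewrite !Ln; ring.
  apply: le_trans (ler_normB _ _) _; rewrite !normrM.
  by apply: lerD; apply: ler_wpM2l.
pose b t := L t k * (v k)^-1.
have bB : zmod_morphism b by move=> s t; rewrite /b LB -mulrBl.
have [beta betaE] : exists beta : {additive R -> R}, forall t, beta t = b t.
  pose bm := GRing.isZmodMorphism.Build R R b bB.
  by exists (HB.pack b bm : {additive R -> R}).
exists beta; split.
- move=> t; apply/funext => l; rewrite betaE /b.
  apply: (mulfI vk); rewrite prop -[RHS]/(v k * (L t k / v k * v l)).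
  by field.
- by exists k, (v k)^-1 => t; rewrite betaE.
- move=> gpos t t0; rewrite leNgt; apply/negP => bt.
  have [B HB] := bnd k.
  suff bt0 : beta t = 0 by rewrite bt0 ltxx in bt.
  apply: (bounded_multiples_eq0 (B := B / `|v k|)) => -[|n].
    rewrite mul0r divr_ge0 //; exact: le_trans (HB 0).
  rewrite ler_pdivlMr ?normr_gt0 //.
  apply: le_trans (HB (t *+ n.+1)).
  have -> : L (t *+ n.+1) k = n.+1%:R * beta t * v k.
    by rewrite Ln betaE /b -!mulrA mulVf // mulr1.
  rewrite -mulrBl normrM ler_wpM2r //.
  have g0 : 0 <= gamma (t *+ n.+1) by apply: gpos; rewrite pmulrn_lgt0.
  have nb : n.+1%:R * beta t <= 0 by rewrite pmulr_rle0 ?ltr0n // ltW.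
  rewrite ger0_norm; last by rewrite subr_ge0 (le_trans nb).
  by rewrite ltr0_norm // mulrN lerDr.
Qed.

Section Rigidity.
Variables (R : realType) (kappa : dimension) (M : nat -> bonding kappa).
Local Notation S := (solenoid R M).
Local Notation V := (idx kappa -> R).
Local Notation E := {ptws idx kappa -> R}.

(** Homotopy classes of self-maps compose like their homomorphisms: since [g]
    inverts [h], the homomorphism [x - b (a x)] is the image of the continuous
    vector-valued function [B (F x) + H (h x)], where [B] lifts [b], and it is
    trivial by [morph_lift_eq0]. *)
Lemma homotopy_inverse (h g : S -> S) (a b : {additive S -> S}) (F H : S -> E) :
  cancel h g -> continuous h -> continuous b ->
  continuous F -> continuous H -> F 0 = 0 -> H 0 = 0 -> h 0 = 0 ->
  (forall x, h x = a x + to_solenoid M (F x)) ->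
  (forall x, g x = b x + to_solenoid M (H x)) ->
  cancel a b.
Proof.
move=> hK ch cb cF cH F0 H0 h0 hE gE.
have [B [cB BE]] := solenoid_endomorphism_lift cb.
pose K x : V := B (F x) + H (h x).
have KE x : x - b (a x) = to_solenoid M (K x).
  have xE : x = b (a x) + (to_solenoid M (B (F x)) + to_solenoid M (H (h x))).
    by rewrite -{1}(hK x) gE {1}hE raddfD /= BE addrA.
  by rewrite {1}xE addrC addKr -raddfD.
have K0 x : K x = 0.
  apply/funext => k.
  apply: (morph_lift_eq0 (psi := fun x => component 0 k (x - b (a x)))
    (K := fun x => K x k) _ _ _ _ _ _ x).
  - exact: solenoid_compact.
  - exact: solenoid_connected.
  - move=> y z; rewrite (_ : y + z - _ = (y - b (a y)) + (z - b (a z))).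
      exact: raddfD.
    by rewrite (raddfD a) (raddfD b) opprD addrACA.
  - have cBF : continuous ((B : E -> E) \o F).
      by move=> y; apply: continuous_comp; [exact: cF|exact: cB].
    have cHh : continuous (H \o h).
      by move=> y; apply: continuous_comp; [exact: ch|exact: cH].
    have c1 : continuous (fun y => B (F y) k) := continuous_eval cBF (i := k).
    have c2 : continuous (fun y => H (h y) k) := continuous_eval cHh (i := k).
    by move=> y; exact: (cvgD (c1 y) (c2 y)).
  - by rewrite /K F0 h0 H0 raddf0 addr0.
  - by move=> y; rewrite KE.
by move=> x; apply/esym/eqP; rewrite -subr_eq0 KE K0 raddf0.
Qed.

End Rigidity.

Theorem theorem6 (R : realType) (kappa : dimension) (M : nat -> bonding kappa)
    (w w' : idx kappa -> R) (hw : w <> 0) (hw' : w' <> 0) :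
  topologically_equivalent (linear_flow M w) (linear_flow M w') ->
  exists (a : {additive solenoid R M -> solenoid R M})
         (beta : {additive R -> R}),
    [/\ homeomorphism a,
        continuous beta,
        {homo beta : s t / s < t}
      & forall (t : R) (x : solenoid R M),
          a (linear_flow M w t x) = linear_flow M w' (beta t) (a x)].
Proof.
move=> [h [[ch [g [hK gK cg]]] equiv]].
pose E := {ptws idx kappa -> R}.
(* Translations commute with linear flows, so the equivalence may be assumed
   to fix 0. *)
pose h0 x := h x - h 0; pose g0 y := g (y + h 0).
have ch0 : continuous h0.
  exact: (tzmod_continuousB ch (@cst_continuous _ _ (h 0))).
have cg0 : continuous g0 by exact: translate_continuous.
have h00 : h0 0 = 0 by rewrite /h0 subrr.
have g00 : g0 0 = 0 by rewrite /g0 add0r hK.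
have h0K : cancel h0 g0 by move=> x; rewrite /g0 /h0 subrK hK.
have g0K : cancel g0 h0 by move=> x; rewrite /g0 /h0 gK addrK.
have [a [F [ca cF F0 hE]]] := solenoid_map_decomposition ch0 h00.
have [b [H [cb cH H0 gE]]] := solenoid_map_decomposition cg0 g00.
have aK : cancel a b by exact: (homotopy_inverse h0K ch0 cb cF cH F0 H0 h00 hE gE).
have bK : cancel b a by exact: (homotopy_inverse g0K cg0 ca cH cF H0 F0 g00 gE hE).
have [A [cA AE]] := solenoid_endomorphism_lift ca.
have [alpha [[calpha _] alpha_incr flowE]] := equiv 0.
(* [alpha 0] is a period of the orbit of 0 under the second flow, possibly a
   nonzero one; subtracting it makes the two lifted paths start together. *)
pose gamma t := alpha t - alpha 0.
have h0E t : h0 (to_solenoid M (t *: w)) = to_solenoid M (alpha t *: w').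
  by have := flowE t; rewrite /linear_flow addr0 /h0 => ->; rewrite addrK.
have alpha0 : to_solenoid M (alpha 0 *: w') = 0.
  by rewrite -h0E scale0r raddf0.
have cline (v : idx kappa -> R) : continuous (fun t : R => (t *: v : E)).
  apply: continuous_ptws => k t.
  by apply: cvgM; [exact: cvg_id|exact: cvg_cst].
have cAline (k : idx kappa) : continuous (fun t : R => A (t *: w) k).
  have cAw : continuous ((A : E -> E) \o (fun t : R => (t *: w : E))).
    by move=> t; apply: continuous_comp; [exact: cline|exact: cA].
  exact: (continuous_eval cAw).
have cFline (k : idx kappa) : continuous (fun t : R => F (to_solenoid M (t *: w)) k).
  have cFw : continuous (F \o (fun t : R => to_solenoid M (t *: w))).
    move=> t; apply: continuous_comp; last exact: cF.
    by apply: to_solenoid_cvg => l; apply: cvgM; [exact: cvg_id|exact: cvg_cst].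
  exact: (continuous_eval cFw).
(* Both sides are lifts of the same path in the solenoid, starting at 0. *)
have orbitE t k : gamma t * w' k - A (t *: w) k = F (to_solenoid M (t *: w)) k.
  pose e (s : R) := gamma s * w' k - A (s *: w) k - F (to_solenoid M (s *: w)) k.
  have ce : continuous e.
    move=> s; apply: cvgB; last exact: cFline.
    apply: cvgB; last exact: cAline.
    apply: cvgM; last exact: cvg_cst.
    by apply: cvgB; [exact: calpha|exact: cvg_cst].
  have eint s : e s \is a Num.int.
    rewrite -to_circle_eq0.
    have : to_solenoid M (gamma s *: w' - A (s *: w) - F (to_solenoid M (s *: w))) = 0.
      rewrite !raddfB /= scalerBl raddfB /= alpha0 subr0 -h0E hE AE.
      by rewrite addrAC addrK subrr.
    by move=> /(congr1 (component 0 k)) e0; apply/eqP; exact: e0.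
  have e00 : e 0 = 0.
    have Aw0 : A (0 *: w) k = 0 by rewrite scale0r raddf0.
    have Fw0 : F (to_solenoid M (0 *: w)) k = 0 by rewrite scale0r raddf0 F0.
    by rewrite /e Aw0 Fw0 /gamma subrr mul0r !subr0.
  have R_connected : connected [set: R] by apply/connected_intervalP.
  have := connected_int_const R_connected ce eint t 0.
  by rewrite e00 => /subr0_eq.
have LB : zmod_morphism (fun t => A (t *: w)).
  by move=> s t; rewrite scalerBl raddfB.
have Fbounded k : exists B, forall t, `|gamma t * w' k - A (t *: w) k| <= B.
  have [B HB] : exists B, forall x, `|F x k| <= B.
    apply: compact_bounded_fun; first exact: solenoid_compact.
    exact: (continuous_eval cF).
  by exists B => t; rewrite orbitE.
have [beta [ALE [k [c betaE]] beta_ge0]] := asymptotic_direction LB hw' Fbounded.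
have {}beta_ge0 : forall t, 0 < t -> 0 <= beta t.
  by apply: beta_ge0 => t t0; rewrite subr_ge0 ltW // alpha_incr.
have flowA t : a (to_solenoid M (t *: w)) = to_solenoid M (beta t *: w').
  by rewrite AE -ALE.
have beta_gt0 t : 0 < t -> 0 < beta t.
  move=> t0; rewrite lt_neqAle beta_ge0 // andbT eq_sym; apply/eqP => bt.
  have [l wl] := neq0_component hw.
  (* If [beta] vanished at [t] it would vanish on [0, t], so [w] would have a
     whole interval of periods; [s] is one for which [s * w l] is too small to
     be a nonzero integer. *)
  pose s := Num.min t (2^-1 / `|w l|).
  have s0 : 0 < s by rewrite lt_min t0 divr_gt0 ?normr_gt0.
  have st : s <= t by rewrite ge_min lexx.
  have bs : beta s = 0.
    apply: le_anti; rewrite beta_ge0 // andbT.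
    have [ts|ts] := eqVneq s t; first by rewrite ts bt.
    have : 0 <= beta (t - s) by apply: beta_ge0; rewrite subr_gt0 lt_neqAle ts.
    by rewrite raddfB /= bt sub0r oppr_ge0.
  have := congr1 b (flowA s); rewrite aK bs scale0r !raddf0.
  move=> /(congr1 (component 0 l)) => /= /eqP; rewrite to_circle_eq0 => sint.
  have := int_lt1_eq0 sint; rewrite -[(s *: w) l]/(s * w l) normrM gtr0_norm // => sl.
  have /sl/eqP : s * `|w l| < 1.
    rewrite -ltr_pdivlMr ?normr_gt0 //; apply: (@le_lt_trans _ _ (2^-1 / `|w l|)).
      by rewrite ge_min lexx orbT.
    by rewrite ltr_pM2r ?invr_gt0 ?normr_gt0 //; lra.
  by rewrite mulf_eq0 (negPf wl) gt_eqF.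
exists a, beta; split.
- by split=> //; exists b.
- rewrite (_ : (beta : R -> R) = fun t => A (t *: w) k * c); last exact/funext.
  by move=> t; apply: cvgM; [exact: cAline|exact: cvg_cst].
- move=> s t st; rewrite -subr_gt0 -raddfB; apply: beta_gt0.
  by rewrite subr_gt0.
- by move=> t x; rewrite /linear_flow raddfD /= flowA.
Qed.
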